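(* Let $f,g$ be probability densities on $\mathbb{R}_+=[0,\infty)$ such that $f\in\mathcal{L}$ and $g(x)=o(f(x))$ as $x\to\infty$. Let $h=f*g$. Then: (i) $h\in\mathcal{S}$ if and only if $f\in\mathcal{S}$. (ii) Assume that $$\int_{\alpha(x)}^{x-\alpha(x)}f(x-y)g(y)\,dy=o(f(x))\quad\text{as }x\to\infty$$ for a function $\alpha(x)$ such that $\alpha(x)<x/2$, $\alpha(x)\to\infty$ as $x\to\infty$, and $f$ is $\alpha$-insensitive. Then $f\in\mathcal{L}\setminus\mathcal{S}$ if and only if $h\in\mathcal{L}\setminus\mathcal{S}$. In both cases (that is, when the equivalent conditions in (i) hold, and when, under the assumption of (ii), the equivalent conditions in (ii) hold), $f(x)\sim h(x)$ as $x\to\infty$.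
   Context: For non-negative functions, $\alpha(x)\sim\beta(x)$ means $\lim_{x\to\infty}\alpha(x)/\beta(x)=1$. For probability densities $f,g$ on $\mathbb{R}$, $f*g(x)=\int_{-\infty}^{\infty}f(x-y)g(y)\,dy$ and $f^{*2}=f*f$. A density on $\mathbb{R}_+$ is regarded as a density on $\mathbb{R}$ vanishing on $(-\infty,0)$. A non-negative measurable function $f$ on $\mathbb{R}$ is long-tailed, $f\in\mathcal{L}$, if $\lim_{x\to\infty}f(x-y)/f(x)=1$ for every $y\in\mathbb{R}$. A probability density $f$ is subexponential, $f\in\mathcal{S}$, if $f\in\mathcal{L}$ and $f^{*2}(x)\sim 2f(x)$ as $x\to\infty$. A function $f$ is $\alpha$-insensitive if $f(x+y)\sim f(x)$ as $x\to\infty$ uniformly in $|y|\le\alpha(x)$, i.e. $\sup_{|y|\le\alpha(x)}|f(x+y)-f(x)|=o(f(x))$ as $x\to\infty$. *)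

(* Defs.v *)
From HB Require Import structures.
From mathcomp Require Import all_boot all_order all_algebra.
From mathcomp Require Import all_classical all_reals all_analysis.

Set Implicit Arguments.
Unset Strict Implicit.
Unset Printing Implicit Defensive.

Import Order.TTheory GRing.Theory Num.Theory.
Import numFieldNormedType.Exports.

Local Open Scope classical_set_scope.
Local Open Scope ring_scope.

Canonical pinfty_filter_on (R : numFieldType) :=
  FilterType (pinfty_nbhs R) _.

Section densities.
Context {R : realType}.
Implicit Types (a b f g : R -> R) (alpha : R -> R).

Local Notation mu := (@lebesgue_measure R).

(* Since [_ / 0 = 0], this forces [b] to be eventually nonzero. *)
Definition asymp_equiv a b : Prop := a x / b x @[x --> +oo] --> (1 : R).

Definition prob_density f : Prop :=
  [/\ measurable_fun [set: R] f, forall x, 0 <= f x &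
      (\int[mu]_x (f x)%:E = 1)%E].

Definition prob_density_Rplus f : Prop :=
  prob_density f /\ forall x, x < 0 -> f x = 0.

(* The convolution of two densities may be infinite on a null set; there
   [Rintegral] returns 0, so [convolution f g] remains a version of the density.
   No asymptotic statement is affected when, for instance, f is long-tailed and
   g = f or g = o(f), with f and g vanishing on the negative half-line: f and g
   are then bounded on compact subsets of a neighbourhood of +oo, so the
   integral is finite for all large x. *)
Definition convolution f g : R -> R := fun x => \int[mu]_y (f (x - y) * g y).

Definition long_tailed f : Prop :=
  [/\ measurable_fun [set: R] f, forall x, 0 <= f x &
      forall y, f (x - y) / f x @[x --> +oo] --> (1 : R)].

Definition subexponential f : Prop :=
  [/\ prob_density f, long_tailed f &
      asymp_equiv (convolution f f) (fun x => 2 * f x)].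

(* The supremum is taken in the extended reals, so that it is +oo when
   [f] is unbounded on the window. *)
Definition insensitive alpha f : Prop :=
  forall eps : R, 0 < eps -> \forall x \near +oo,
    (ereal_sup [set `|f (x + y) - f x|%:E | y in [set y | `|y| <= alpha x]%R]
      <= (eps * f x)%:E)%E.

End densities.

(* Main.v *)
Require Import Defs.
From HB Require Import structures.
From mathcomp Require Import all_boot all_order all_algebra.
From mathcomp Require Import all_classical all_reals all_analysis.
From mathcomp Require Import measurable_realfun.
From mathcomp Require Import ring lra.
Set Implicit Arguments.
Unset Strict Implicit.
Unset Printing Implicit Defensive.
Import Order.TTheory GRing.Theory Num.Theory.
Import numFieldNormedType.Exports.
Local Open Scope classical_set_scope.
Local Open Scope ring_scope.

(** The convolution is cut at [a] and [x - a]: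

      h(x) = \int_{y < a} f(x-y) g(y) dy + \int_{[a, x-a]} f(x-y) g(y) dy
             + \int_{z < a} f(z) g(x-z) dz.

    When [f] varies little on [[x - a, x]], the first head is f(x) times the
    mass of [g] below [a], so it is close to f(x) once [a] is large; the last
    head is o(f(x)) because g = o(f) and f(x-z) is comparable to f(x). Hence
    f ~ h as soon as the middle part is o(f)
    ([asymp_equiv_convolution]). In part (ii) this is exactly what is assumed,
    with a = alpha(x). In part (i), [a] is a large constant [A]: a long-tailed
    [f] varies little on every window of bounded width
    ([long_tailed_uniform]), and the middle part has to be made small by
    letting x tend to infinity first and [A] afterwards ([negligible_middle]).

    The same cut applied to f * f shows that a long-tailed density [f] is
    subexponential iff the middle part of f * f is negligible with respect to
    [f]. This criterion is stable under domination, since only large arguments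
    occur in the middle part ([negligible_middle_dominated]); so
    subexponentiality passes from a density to any asymptotically equivalent
    one ([subexponential_asymp]). Therefore everything reduces to f ~ h.

    If [f] is subexponential, the middle part of f * g is dominated by that of
    f * f, and f ~ h. Conversely, let [h] be subexponential. The first head
    alone gives f <= 2 h far out, hence also g <= 2 h, so the middle part of
    f * g is dominated by that of h * h and is negligible with respect to [h].
    With constant 1/2 it can be absorbed in h(x) = heads + middle, which leaves
    h <= 8 f. The middle part is then negligible with respect to [f], and
    f ~ h again ([convolution_subexponential_asymp]).

    Pointwise finiteness of the convolution is needed far out only, and
    follows from boundedness of long-tailed functions on bounded intervals far
    out ([near_conv_over_fin]). *)

(** * Invariance of the Lebesgue measure *)

Lemma measurable_reflect {R : realType} (x : R) :
  measurable_fun [set: measurableTypeR R]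
    (fun y : R => x - y : measurableTypeR R).
Proof. exact: measurable_funB. Qed.

Lemma lebesgue_measure_reflect {R : realType} (x : R) (A : set R) :
  measurable A ->
  lebesgue_measure ((fun y : R => x - y) @^-1` A) = lebesgue_measure A.
Proof.
move=> mA.
rewrite -[LHS]/(pushforward lebesgue_measure
  (fun y : R => x - y : measurableTypeR R) A).
apply/esym/lebesgue_measure_unique => //=; first exact: measurable_reflect.
move=> _ _ [[a b]] _ <-; rewrite /pushforward.
have -> : (fun y : R => x - y) @^-1` `]a, b] = `[x - b, x - a[%classic.
  apply/seteqP; split=> z /=; rewrite !in_itv/= => /andP[? ?].
    by apply/andP; split; lra.
  by apply/andP; split; lra.
rewrite !lebesgue_measure_itv/= !lte_fin ltrD2l ltrN2.
by case: ifP => // _; rewrite -!EFinB; congr EFin; ring.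
Qed.

Lemma lebesgue_measure_shift {R : realType} (x : R) (A : set R) :
  measurable A ->
  lebesgue_measure ((fun y : R => y - x) @^-1` A) = lebesgue_measure A.
Proof.
move=> mA.
have mB : measurable ((fun y : R => 0 - y) @^-1` A).
  by rewrite -[X in measurable X]setTI; exact: measurable_reflect.
rewrite -(lebesgue_measure_reflect 0 mA) -(lebesgue_measure_reflect x mB).
by congr (lebesgue_measure _); apply/funext => y /=; congr A; ring.
Qed.

(** Invariance of the Lebesgue measure under [y |-> x - y] is what exchanges the
    two factors of a convolution. *)
Lemma integral_reflect {R : realType} (x : R) (D : set R) (f : R -> \bar R) :
  measurable D -> measurable_fun [set: R] f -> (forall y, 0 <= f y)%E ->
  (\int[lebesgue_measure]_(y in D) f y =
   \int[lebesgue_measure]_(y in (fun y => x - y)%R @^-1` D) f (x - y)%R)%E.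
Proof.
move=> mD mf f0.
rewrite -(ge0_integral_pushforward (measurable_reflect x))//; last first.
  exact: measurable_funTS.
apply: eq_measure_integral => [|mx A mA _]; first exact: measurable_reflect.
exact/esym/lebesgue_measure_reflect.
Qed.

(** * Uniformity of long tails *)

Lemma long_tailed_gt0 {R : realType} (f : R -> R) :
  long_tailed f -> \forall x \near +oo, 0 < f x.
Proof.
move=> [_ f0 /(_ 0)/cvgrPdist_lt/(_ _ ltr01)]; apply: filterS => x.
rewrite subr0 => fx; rewrite lt_neqAle f0 andbT eq_sym.
by apply: contraTneq fx => ->; rewrite invr0 mulr0 subr0 normr1 ltxx.
Qed.

Lemma measurable_window_defect {R : realType} (f : R -> R) (A eta x : R) :
  measurable_fun [set: R] f ->
  measurable (`[- A, A] `&` [set u | eta * f x < `|f (x + u) - f x|]).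
Proof.
move=> mf; apply: measurableI => //.
rewrite -[X in measurable X]setTI; apply: measurable_fun_ltr => //.
apply: measurableT_comp => //; apply: measurable_funB => //.
by apply: (@measurableT_comp _ _ _ _ _ _ f) => //; exact: measurable_funD.
Qed.

(** The pointwise convergence in the definition of long tails gives convergence
    in measure on a bounded window, by dominated convergence for indicator
    functions; the limit along the reals is tested along sequences. *)
Lemma window_defect_cvg0 {R : realType} (f : R -> R) (A eta : R) :
  long_tailed f -> 0 < eta ->
  lebesgue_measure (`[- A, A] `&` [set u | eta * f x < `|f (x + u) - f x|])
    @[x --> +oo] --> 0%E.
Proof.
move=> fL' eta0; have [mf f0 fL] := fL'.
apply/cvge_pinftyP => u uy; set D : set R := `[- A, A]%classic.
have mD : measurable D by exact: measurable_itv.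
have muD : (lebesgue_measure D < +oo)%E.
  by rewrite lebesgue_measure_itv/=; case: ifP => // _; rewrite ltry.
pose E n := D `&` [set v | eta * f (u n) < `|f (u n + v) - f (u n)|].
have mE n : measurable (E n) by exact: measurable_window_defect.
have fu y : \forall n \near \oo, `|f (u n + y) - f (u n)| <= eta * f (u n).
  have := fL (- y) => /cvgrPdist_le /(_ _ eta0) fy.
  have fp := long_tailed_gt0 fL'.
  have {}fy := uy _ fy. have {}fp := uy _ fp.
  near=> n.
  have fn : 0 < f (u n) by near: n.
  have : `|1 - f (u n - - y) / f (u n)| <= eta by near: n.
  rewrite opprK -(ler_pM2r fn) -[X in _ * X <= _ -> _](gtr0_norm fn) -normrM.
  rewrite mulrBl mul1r divfK ?gt_eqF// => ?; rewrite distrC.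
  by rewrite (le_trans _ (y:= eta * f (u n))).
have -> : (fun n => lebesgue_measure (D `&`
    [set v | eta * f (u n) < `|f (u n + v) - f (u n)|])) =
    (fun n => \int[lebesgue_measure]_(y in D) (\1_(E n) y)%:E)%E.
  apply/funext => n; rewrite integral_indic//=; last exact: mE.
  by rewrite -[LHS]/(lebesgue_measure (E n)) setIidl// => v [].
have [|||||_ _] := @dominated_convergence _ _ _ (@lebesgue_measure R)
   D mD (fun n y => (\1_(E n) y)%:E) (cst 0%E) (cst 1%E).
- move=> n; apply/measurable_EFinP/measurable_funTS.
  by apply: measurable_indic; exact: mE.
- exact: measurable_cst.
- apply/aeW => y yA; apply: cvg_near_cst; near=> n.
  have : `|f (u n + y) - f (u n)| <= eta * f (u n) by near: n; exact: fu.
  rewrite leNgt => /negP yE; rewrite indicE memNset//.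
  by move=> [_].
- apply/integrableP; split => //.
  rewrite (eq_integral (cst 1%E)) => [|y _]; last by rewrite gee0_abs.
  rewrite integral_cst// mul1e.
  exact: muD.
- apply/aeW => y n _; rewrite lee_fin ger0_norm indicE; case: (_ \in _) => //.
- by rewrite integral_cst// mul0e.
Unshelve. all: by end_near. Qed.

(** The uniform convergence theorem of regular variation, in additive form.
    If [f (x + y)] were far from [f x] for some [y] in [[- A, A]], then no point
    [x + u] with [u] in [[- A, A]] could have its value close to both, so
    [[- A, A]] would be covered by the defect set of [x] and a translate of
    that of [x + y]. Far out both have measure less than [A]. *)
Lemma long_tailed_uniform {R : realType} (f : R -> R) (A eps : R) :
  long_tailed f -> 0 < eps ->
  \forall x \near +oo, forall y, `|y| <= A -> `|f (x + y) - f x| <= eps * f x.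
Proof.
move=> fL eps0; have [mf f0 _] := fL.
wlog A0 : A / 0 < A => [wA|].
  apply: filterS (wA (Num.max A 1) _) => [x + y yA|]; last first.
    by rewrite lt_max ltr01 orbT.
  by apply; rewrite le_max yA.
(* Closeness within [eta] to both values forces them to agree within
   [2 eta / (1 - eta) <= 4 eta <= eps]. *)
pose eta := Num.min (1 / 2) (eps / 4).
have eta0 : 0 < eta by rewrite lt_min; apply/andP; split; lra.
have eta2 : eta <= 1 / 2 by rewrite ge_min lexx.
have eta4 : eta <= eps / 4 by rewrite ge_min lexx orbT.
(* The window is doubled, so that it contains [u - y] for [u], [y] in
   [[- A, A]]. *)
pose E x : set R :=
  `[- (2 * A), 2 * A] `&` [set u | eta * f x < `|f (x + u) - f x|].
have mE x : measurable (E x) by exact: measurable_window_defect.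
have : \forall x \near +oo, (lebesgue_measure (E x) < A%:E)%E.
  have := @window_defect_cvg0 _ _ (2 * A) _ fL eta0.
  move=> cE; apply: (cE [set z | z < A%:E]%E).
  by apply: open_ereal_lt'; rewrite lte_fin.
move=> [X [_ EX]]; exists (X + A); split; first exact: num_real.
move=> x xX y yA; have {yA} /andP[yA1 yA2] : - A <= y <= A by rewrite -ler_norml.
have Ex : (lebesgue_measure (E x) < A%:E)%E by apply: EX; lra.
have Exy : (lebesgue_measure (E (x + y)%R) < A%:E)%E by apply: EX; lra.
rewrite leNgt; apply/negP => fxy.
have cov : `[- A, A] `<=` E x `|` (fun u => u - y) @^-1` (E (x + y)).
  move=> u /=; rewrite in_itv/= => /andP[u1 u2]; apply: contrapT => /not_orP[].
  move=> /not_andP[[]|/negP].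
    by rewrite /= in_itv/=; apply/andP; split; lra.
  rewrite -leNgt => h1 /not_andP[[]|/negP].
    by rewrite /= in_itv/=; apply/andP; split; lra.
  rewrite -leNgt (_ : x + y + (u - y) = x + u); last ring.
  move: h1 fxy; have := f0 x; have := f0 (x + y).
  move: (f x) (f (x + y)) (f (x + u)) => p q r q0 p0.
  rewrite !ler_norml => /andP[h1 h2] + /andP[h3 h4].
  rewrite ltNge => /negP; apply; rewrite ler_norml; apply/andP; split; nra.
have mF : measurable ((fun u => u - y) @^-1` (E (x + y))).
  rewrite -[X in measurable X]setTI; apply: (measurable_funB _ _) => //.
have mU : measurable (E x `|` (fun u => u - y) @^-1` E (x + y)).
  exact: measurableU.
have : (lebesgue_measure `[(- A)%R, A] <=
    lebesgue_measure (E x) + lebesgue_measure (E (x + y)%R))%E.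
  rewrite -(@lebesgue_measure_shift _ y (E (x + y)))//.
  apply: (@le_trans _ _ (lebesgue_measure
      (E x `|` (fun u => u - y) @^-1` E (x + y)))).
    by apply: le_measure; rewrite ?inE//; exact: mU.
  by apply: measureU2; [exact: mE | exact: mF].
rewrite leNgt => /negP; apply.
rewrite lebesgue_measure_itv/= lte_fin ifT; last lra.
by rewrite -EFinB opprK EFinD; exact: lteD.
Qed.

(** * Cutting the convolution integral *)

(** The extended-real value keeps apart a vanishing and a divergent integral,
    both of which [convolution] sends to 0. *)
Definition conv_over {R : realType} (f g : R -> R) (D : set R) (x : R) : \bar R :=
  (\int[lebesgue_measure]_(y in D) (f (x - y) * g y)%:E)%E.

Definition head_mass {R : realType} (f : R -> R) (a : R) : \bar R :=
  (\int[lebesgue_measure]_(y in `]-oo, a[) (f y)%:E)%E.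

Lemma convolutionE {R : realType} (f g : R -> R) x :
  convolution f g x = fine (conv_over f g setT x).
Proof. by []. Qed.

Lemma measurable_conv_integrand {R : realType} (f g : R -> R) (x : R) :
  measurable_fun [set: R] f -> measurable_fun [set: R] g ->
  measurable_fun [set: R] (fun y => (f (x - y) * g y)%:E).
Proof.
move=> mf mg; apply/measurable_EFinP/measurable_funM => //.
by apply: (@measurableT_comp _ _ _ _ _ _ f) => //; exact: measurable_funB.
Qed.

Lemma conv_over_ge0 {R : realType} (f g : R -> R) D (x : R) :
  (forall y, 0 <= f y) -> (forall y, 0 <= g y) -> (0 <= conv_over f g D x)%E.
Proof. by move=> f0 g0; apply: integral_ge0 => y _; rewrite lee_fin mulr_ge0. Qed.

Lemma conv_over_le {R : realType} (f g : R -> R) (D D' : set R) (x : R) :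
  prob_density f -> prob_density g ->
  measurable D -> measurable D' -> D `<=` D' ->
  (conv_over f g D x <= conv_over f g D' x)%E.
Proof.
move=> [mf f0 _] [mg g0 _] mD mD' DD'; apply: ge0_subset_integral => //.
- by apply: measurable_funTS; exact: measurable_conv_integrand.
- by move=> y _; rewrite lee_fin mulr_ge0.
Qed.

(** The part of the integral beyond [x - a] becomes the head of [g] against [f]
    under the substitution [y |-> x - y]. *)
Lemma conv_over_split {R : realType} (f g : R -> R) (a x : R) :
  prob_density f -> prob_density g -> a <= x - a ->
  (conv_over f g setT x =
    conv_over f g `]-oo, a[ x + conv_over f g `[a, (x - a)%R] x
    + conv_over g f `]-oo, a[ x)%E.
Proof.
move=> [mf f0 _] [mg g0 _] ax.
have mfg := measurable_conv_integrand x mf mg.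
have mgf := measurable_conv_integrand x mg mf.
have fg0 y : (0 <= (f (x - y) * g y)%:E)%E by rewrite lee_fin mulr_ge0.
have -> : conv_over g f `]-oo, a[ x = conv_over f g `]x - a, +oo[ x.
  rewrite /conv_over (integral_reflect x)//; last first.
    by move=> y; rewrite lee_fin mulr_ge0.
  have -> : (fun y => x - y) @^-1` `]-oo, a[ = `]x - a, +oo[%classic.
    by apply/seteqP; split => y /=; rewrite !in_itv/= ?andbT; lra.
  by apply: eq_integral => y _; rewrite mulrC subKr.
rewrite /conv_over.
have -> : [set: R] = `]-oo, x - a] `|` `]x - a, +oo[%classic.
  apply/seteqP; split => // y _ /=; rewrite !in_itv/= andbT.
  by case: (leP y (x - a)); [left | right].
rewrite ge0_integral_setU//; last 2 first.
- exact: measurable_funTS.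
- apply/disj_setPS => y /= [] ; rewrite !in_itv/= andbT; lra.
have -> : `]-oo, x - a]%classic = `]-oo, a[ `|` `[a, x - a]%classic :> set R.
  apply/seteqP; split => y /=; rewrite !in_itv/=.
    by case: (ltP y a); [left | right].
  by move=> [|/andP[]//]; lra.
rewrite ge0_integral_setU//.
- exact: measurable_funTS.
- apply/disj_setPS => y /= [] ; rewrite !in_itv/= => + /andP[]; lra.
Qed.

Lemma conv_over_head_le {R : realType} (f g : R -> R) (a x u : R) :
  prob_density_Rplus f -> prob_density_Rplus g ->
  (forall y, 0 <= y -> y < a -> f (x - y) <= u) ->
  (conv_over f g `]-oo, a[ x <= u%:E * head_mass g a)%E.
Proof.
move=> [[mf f0 _] fN] [[mg g0 _] gN] fu.
have [a0|a0] := leP a 0.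
  rewrite /conv_over /head_mass [X in (X <= _)%E]integral0_eq => [|y].
    rewrite integral0_eq ?mule0// => y; rewrite /= in_itv/= => ya.
    by rewrite gN//; lra.
  by rewrite /= in_itv/= => ya; rewrite gN ?mulr0//; lra.
have u0 : 0 <= u by apply: le_trans (fu 0 _ a0).
rewrite /head_mass -ge0_integralZl_EFin//; last 2 first.
- by move=> y _; rewrite lee_fin.
- by apply: measurable_funTS; exact/measurable_EFinP.
apply: ge0_le_integral => //.
- by move=> y _; rewrite lee_fin mulr_ge0.
- by apply: measurable_funTS; exact: measurable_conv_integrand.
- apply: measurable_funTS; apply/measurable_EFinP; exact: measurable_funM.
- move=> y; rewrite /= in_itv/= => ya; rewrite -EFinM lee_fin.
  have [y0|y0] := ltP y 0; first by rewrite gN ?mulr0.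
  by rewrite ler_wpM2r// fu.
Qed.

Lemma conv_over_head_ge {R : realType} (f g : R -> R) (a x l : R) :
  prob_density_Rplus f -> prob_density_Rplus g -> 0 <= l ->
  (forall y, 0 <= y -> y < a -> l <= f (x - y)) ->
  (l%:E * head_mass g a <= conv_over f g `]-oo, a[ x)%E.
Proof.
move=> [[mf f0 _] fN] [[mg g0 _] gN] l0 fl.
rewrite /head_mass -ge0_integralZl_EFin//; last 2 first.
- by move=> y _; rewrite lee_fin.
- by apply: measurable_funTS; exact/measurable_EFinP.
apply: ge0_le_integral => //.
- by move=> y _; rewrite -EFinM lee_fin mulr_ge0.
- apply: measurable_funTS; apply/measurable_EFinP; exact: measurable_funM.
- by apply: measurable_funTS; exact: measurable_conv_integrand.
- move=> y; rewrite /= in_itv/= => ya; rewrite -EFinM lee_fin.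
  have [y0|y0] := ltP y 0; first by rewrite gN ?mulr0.
  by rewrite ler_wpM2r// fl.
Qed.

Lemma head_mass_ge0 {R : realType} (f : R -> R) a :
  prob_density f -> (0 <= head_mass f a)%E.
Proof. by move=> [_ f0 _]; apply: integral_ge0 => y _; rewrite lee_fin. Qed.

Lemma head_mass_le1 {R : realType} (f : R -> R) a :
  prob_density f -> (head_mass f a <= 1)%E.
Proof.
move=> [mf f0 <-]; apply: ge0_subset_integral => //; last first.
  by move=> y _; rewrite lee_fin.
exact/measurable_EFinP.
Qed.

Lemma head_mass_fin_num {R : realType} (f : R -> R) a :
  prob_density f -> head_mass f a \is a fin_num.
Proof.
move=> fd; rewrite ge0_fin_numE ?head_mass_ge0//.
by rewrite (le_lt_trans (head_mass_le1 a fd))// ltry.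
Qed.

(** A density has mass arbitrarily close to 1 below [a], by monotone convergence
    along the integers. *)
Lemma head_mass_cvg1 {R : realType} (f : R -> R) (d : R) :
  prob_density f -> 0 < d -> \forall a \near +oo, ((1 - d)%:E <= head_mass f a)%E.
Proof.
move=> fd d0; have [mf f0 f1] := fd.
pose F n : set R := `]-oo, n%:R[%classic.
have cF : head_mass f n%:R @[n --> \oo] --> 1%E.
  have -> : 1%E = (\int[lebesgue_measure]_(y in \bigcup_n F n) (f y)%:E)%E.
    rewrite -f1; congr integral; apply/esym/seteqP; split => // y _.
    have [n yn] : exists n : nat, y < n%:R.
      exists (Num.truncn `|y|).+1.
      by rewrite (le_lt_trans (ler_norm y))// truncnS_gt.
    by exists n => //=; rewrite in_itv.
  apply: ge0_nondecreasing_set_cvg_integral.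
  - apply/nondecreasing_seqP => n; rewrite subsetEset => y.
    rewrite /F/= !in_itv/=.
    by move=> /lt_le_trans; apply; rewrite ler_nat.
  - by move=> n; exact: measurable_itv.
  - by move=> n; apply: measurable_funTS; exact/measurable_EFinP.
  - by move=> n y _; rewrite lee_fin.
have [|N _ /(_ N (leqnn N)) /= dN] := cF [set z | (1 - d)%:E < z]%E.
  by apply: open_ereal_gt'; rewrite lte_fin; lra.
exists N%:R; split; first exact: num_real.
move=> a Na; apply: (le_trans (ltW dN)); apply: ge0_subset_integral => //.
- by apply: measurable_funTS; exact/measurable_EFinP.
- by move=> y _; rewrite lee_fin.
- by move=> y /=; rewrite !in_itv/= => /lt_trans; apply.
Qed.

(** * Asymptotic equivalence and long tails *)

Lemma asymp_equiv_sym {R : realType} (a b : R -> R) :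
  asymp_equiv a b -> asymp_equiv b a.
Proof.
move=> ab; rewrite /asymp_equiv -[1]invr1.
under eq_fun do rewrite -invf_div.
by apply: cvgV; rewrite ?oner_neq0.
Qed.

Lemma asymp_equiv_gt0 {R : realType} (a b : R -> R) :
  (forall x, 0 <= b x) -> asymp_equiv a b -> \forall x \near +oo, 0 < b x.
Proof.
move=> b0 /cvgrPdist_lt/(_ _ ltr01); apply: filterS => x bx.
rewrite lt_neqAle b0 andbT eq_sym.
by apply: contraTneq bx => ->; rewrite invr0 mulr0 subr0 normr1 ltxx.
Qed.

Lemma asymp_equivP {R : realType} (a b : R -> R) :
  (\forall x \near +oo, 0 < b x) ->
  asymp_equiv a b <->
  forall eps, 0 < eps -> \forall x \near +oo, `|a x - b x| <= eps * b x.
Proof.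
move=> b0; have eqE x eps : 0 < b x ->
    (`|1 - a x / b x| <= eps) = (`|a x - b x| <= eps * b x).
  move=> bx; rewrite -(ler_pM2r bx) -[X in `|_| * X]gtr0_norm// -normrM.
  by rewrite mulrBl mul1r divfK ?gt_eqF// distrC.
split=> [ab eps eps0|ab].
  move/cvgrPdist_le : ab => /(_ _ eps0) ab; near=> x.
  by rewrite -eqE; near: x.
apply/cvgrPdist_le => eps eps0; have {}ab := ab _ eps0; near=> x.
by rewrite eqE; near: x.
Unshelve. all: by end_near. Qed.

Lemma near_pinfty_lt {R : realType} (X : R) : \forall x \near +oo, X < x.
Proof. by apply: nbhs_pinfty_gt; exact: num_real. Qed.

Lemma near_pinfty_subr {R : realType} (P : set R) (y : R) :
  (\forall x \near +oo, P x) -> \forall x \near +oo, P (x - y).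
Proof.
move=> [X [_ PX]]; exists (X + y); split; first exact: num_real.
by move=> x xX; apply: PX; lra.
Qed.

(** Factor [h (x - y) / h x] as
    [h (x - y) / f (x - y) * (f (x - y) / f x) * (f x / h x)]. *)
Lemma long_tailed_asymp {R : realType} (f h : R -> R) :
  measurable_fun [set: R] h -> (forall x, 0 <= h x) ->
  asymp_equiv f h -> long_tailed f -> long_tailed h.
Proof.
move=> mh h0 fh fL; split=> // y; have [_ f0 fy] := fL.
have fp := long_tailed_gt0 fL; have hp := asymp_equiv_gt0 h0 fh.
have fpy := near_pinfty_subr y fp.
have hf : h (x - y) / f (x - y) @[x --> +oo] --> (1 : R).
  have sy : x - y @[x --> +oo] --> +oo by move=> P /(near_pinfty_subr y).
  exact: (cvg_comp _ _ sy (asymp_equiv_sym fh)).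
have := cvgM (cvgM hf (fy y)) fh; rewrite !mulr1 => /(_ _ _) fhh.
apply: cvg_trans fhh.
apply: near_eq_cvg; near=> x.
have hx : 0 < h x by near: x.
have fx : 0 < f x by near: x.
have fxy : 0 < f (x - y) by near: x.
by rewrite /=; field; rewrite !gt_eqF.
Unshelve. all: by end_near. Qed.

Lemma asymp_equiv_le2 {R : realType} (a b : R -> R) :
  (forall x, 0 <= b x) -> asymp_equiv a b -> \forall x \near +oo, a x <= 2 * b x.
Proof.
move=> b0 ab; have bp := asymp_equiv_gt0 b0 ab.
move: ab => /(asymp_equivP _ bp)/(_ _ ltr01); apply: filterS => x.
rewrite ler_norml => /andP[_]; lra.
Qed.

(** Boundedness on bounded intervals far out. Near the origin a long-tailed
    density can be unbounded. *)
Definition tail_bounded {R : realType} (f : R -> R) : Prop :=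
  exists X, forall Y, exists B, forall t, X <= t -> t <= Y -> f t <= B.

(** Far out, [f] at most doubles over a step of length at most 1, so [n] steps
    give the bound [2 ^+ n * f (X + 1)]. *)
Lemma long_tailed_tail_bounded {R : realType} (f : R -> R) :
  long_tailed f -> tail_bounded f.
Proof.
move=> fL; have [_ f0 _] := fL.
have [X [_ fX]] := @long_tailed_uniform _ _ 1 1 fL ltr01.
have step x y : X < x -> `|y| <= 1 -> f (x + y) <= 2 * f x.
  by move=> /fX /[apply]; rewrite ler_norml => /andP[_]; lra.
exists (X + 1) => Y.
suff H n t : X + 1 <= t -> t <= X + 1 + n%:R -> f t <= 2 ^+ n * f (X + 1).
  exists (2 ^+ (Num.truncn `|Y - (X + 1)|).+1 * f (X + 1)) => t Xt tY.
  apply: H => //; rewrite (le_trans tY)// -lerBlDl.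
  by rewrite (le_trans (ler_norm _))// ltW// truncnS_gt.
elim: n t => [t Xt tX|n IH t Xt tX].
  by rewrite (_ : t = X + 1) ?expr0 ?mul1r//; lra.
have [tn|tn] := leP t (X + 1 + 1).
  have := step (X + 1) (t - (X + 1)); rewrite subrKC => /(_ _ _)/le_trans; apply.
  - lra.
  - rewrite ler_norml; lra.
  rewrite ler_wpM2r// exprS -[leLHS]mulr1 ler_wpM2l// exprn_ege1//; lra.
have := step (t - 1) 1; rewrite subrK => /(_ _ _)/le_trans; apply.
- lra.
- by rewrite normr1.
rewrite exprS -mulrA ler_pM2l// IH//; first lra.
by move: tX; rewrite -natr1; lra.
Qed.

Lemma tail_bounded_le {R : realType} (f g : R -> R) (c : R) : 0 <= c ->
  (\forall x \near +oo, g x <= c * f x) -> tail_bounded f -> tail_bounded g.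
Proof.
move=> c0 [X [_ gf]] [X' fB]; exists (Num.max (X + 1) X') => Y.
have [B fY] := fB Y; exists (c * B) => t; rewrite ge_max => /andP[tX tX'] tY.
apply: (@le_trans _ _ (c * f t)); first by apply: gf; lra.
by rewrite ler_wpM2l// fY.
Qed.

(** Cut at [a = x / 2]: on each half one factor is evaluated far out only and is
    bounded there, and the other one is integrable. *)
Lemma near_conv_over_fin {R : realType} (f g : R -> R) :
  prob_density_Rplus f -> prob_density_Rplus g ->
  tail_bounded f -> tail_bounded g ->
  \forall x \near +oo, (conv_over f g setT x < +oo)%E.
Proof.
move=> fd gd [X fX] [X' gX].
exists (2 * Num.max X X'); split=> [|x xX]; first exact: num_real.
have mX : X <= Num.max X X' by rewrite le_max lexx.
have mX' : X' <= Num.max X X' by rewrite le_max lexx orbT.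
have [B fB] := fX x; have [B' gB] := gX x.
have [[pf _] [pg _]] := (fd, gd).
rewrite (conv_over_split (a := x / 2) pf pg); last lra.
have -> : conv_over f g `[x / 2, x - x / 2] x = 0%E.
  apply: (@integral_Sset1 _ _ _ (x / 2)) => y /=; rewrite in_itv/= => /andP[].
  lra.
rewrite adde0 lte_add_pinfty//.
- apply: (le_lt_trans (conv_over_head_le (u := B) fd gd _)).
    by move=> y y0 yx; apply: fB; lra.
  by rewrite -(fineK (head_mass_fin_num _ pg)) -EFinM ltry.
- apply: (le_lt_trans (conv_over_head_le (u := B') gd fd _)).
    by move=> y y0 yx; apply: gB; lra.
  by rewrite -(fineK (head_mass_fin_num _ pf)) -EFinM ltry.
Qed.

(** * Negligible middle parts and subexponentiality *)

(** One-sided: a head of the convolution at [x] only looks at the values of [f] to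
    the left of [x]. *)
Definition flat_window {R : realType} (f : R -> R) (eps a x : R) : Prop :=
  forall y, 0 <= y -> y < a -> `|f (x - y) - f x| <= eps * f x.

Lemma flat_window_head_le {R : realType} (f g : R -> R) (eps a x : R) :
  prob_density_Rplus f -> prob_density_Rplus g -> 0 <= eps ->
  flat_window f eps a x ->
  (conv_over f g `]-oo, a[ x <= ((1 + eps) * f x)%:E)%E.
Proof.
move=> fd gd eps0 fa; have [[mf f0 _] _] := fd; have [pg _] := gd.
apply: (le_trans (conv_over_head_le (u := (1 + eps) * f x) fd gd _)).
  by move=> y y0 ya; have := fa y y0 ya; rewrite ler_norml => /andP[_]; lra.
rewrite -[leRHS]mule1 lee_wpmul2l ?head_mass_le1//.
by rewrite lee_fin mulr_ge0//; lra.
Qed.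

Lemma flat_window_head_ge {R : realType} (f g : R -> R) (eps a x : R) :
  prob_density_Rplus f -> prob_density_Rplus g -> 0 <= eps -> eps <= 1 ->
  flat_window f eps a x -> ((1 - eps)%:E <= head_mass g a)%E ->
  (((1 - 2 * eps) * f x)%:E <= conv_over f g `]-oo, a[ x)%E.
Proof.
move=> fd gd eps0 eps1 fa ga; have [[mf f0 _] _] := fd; have [pg _] := gd.
apply: (le_trans _ (conv_over_head_ge (l := (1 - eps) * f x) fd gd _ _)).
- apply: (@le_trans _ _ (((1 - eps) * f x)%:E * (1 - eps)%:E)%E).
    rewrite -EFinM lee_fin; have := f0 x; nra.
  by rewrite lee_wpmul2l// lee_fin mulr_ge0//; lra.
- by rewrite mulr_ge0//; lra.
- by move=> y y0 ya; have := fa y y0 ya; rewrite ler_norml => /andP[+ _]; lra.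
Qed.

Lemma flat_window_head2_le {R : realType} (f g : R -> R) (c eps a x : R) :
  prob_density_Rplus f -> prob_density_Rplus g ->
  0 <= c -> 0 <= eps -> eps <= 1 ->
  flat_window f eps a x ->
  (forall y, 0 <= y -> y < a -> g (x - y) <= c * f (x - y)) ->
  (conv_over g f `]-oo, a[ x <= (2 * c * f x)%:E)%E.
Proof.
move=> fd gd c0 eps0 eps1 fa gf; have [[mf f0 _] _] := fd; have [pf _] := fd.
have fx := f0 x.
apply: (le_trans (conv_over_head_le (u := 2 * c * f x) gd fd _)).
  move=> y y0 ya; have := fa y y0 ya; rewrite ler_norml => /andP[_ fy].
  apply: (le_trans (gf y y0 ya)); rewrite [2 * c]mulrC -mulrA ler_wpM2l//; nra.
rewrite -[leRHS]mule1 lee_wpmul2l ?head_mass_le1//.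
by rewrite lee_fin !mulr_ge0.
Qed.

Lemma near_flat_window {R : realType} (f : R -> R) (eps A : R) :
  long_tailed f -> 0 < eps -> \forall x \near +oo, flat_window f eps A x.
Proof.
move=> fL eps0; apply: filterS (long_tailed_uniform A fL eps0) => x fx y y0 yA.
by apply: fx; rewrite normrN ger0_norm// ltW.
Qed.

(** The cut may depend on [x], so that this covers both a constant [A] and the
    window width [alpha x] of an insensitive function. *)
Lemma asymp_equiv_convolution {R : realType} (f g : R -> R) :
  prob_density_Rplus f -> prob_density_Rplus g -> long_tailed f ->
  (forall eps, 0 < eps -> eps <= 1 -> \forall x \near +oo, exists a,
    [/\ a <= x - a, flat_window f eps a x,
        forall y, 0 <= y -> y < a -> g (x - y) <= eps * f (x - y),
        ((1 - eps)%:E <= head_mass g a)%E &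
        (conv_over f g `[a, (x - a)%R] x <= (eps * f x)%:E)%E]) ->
  asymp_equiv f (convolution f g).
Proof.
move=> fd gd fL H; apply: asymp_equiv_sym.
have [pf _] := fd; have [pg _] := gd; have [mf f0 _] := fL.
have g0 : forall x, 0 <= g x by case: pg.
apply/(asymp_equivP _ (long_tailed_gt0 fL)) => e e0.
(* The heads and the middle part add up to at most [1 + eps + 2 eps + eps]
   times [f x]. *)
pose eps := Num.min 1 (e / 4).
have eps0 : 0 < eps by rewrite lt_min ltr01; lra.
have eps1 : eps <= 1 by rewrite ge_min lexx.
have epse : eps <= e / 4 by rewrite ge_min lexx orbT.
apply: filterS (H _ eps0 eps1) => x [a [ax fa gf ga mid]].
have h1 := flat_window_head_le fd gd (ltW eps0) fa.
have h2 := flat_window_head_ge fd gd (ltW eps0) eps1 fa ga.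
have h3 := flat_window_head2_le fd gd (ltW eps0) (ltW eps0) eps1 fa gf.
rewrite convolutionE (conv_over_split pf pg ax).
move: h1 h2 h3 mid (conv_over_ge0 `[a, (x - a)%R] x f0 g0)
  (conv_over_ge0 `]-oo, a[ x g0 f0).
case: (conv_over f g `]-oo, a[ x) => [p||]//.
case: (conv_over f g `[a, (x - a)%R] x) => [q||]//.
case: (conv_over g f `]-oo, a[ x) => [r||]//.
rewrite !lee_fin /= => h1 h2 h3 h4 h5 h6.
have fx := f0 x.
have : eps * f x <= e / 4 * f x by rewrite ler_wpM2r.
rewrite ler_norml => h7; apply/andP; split; lra.
Qed.

(** An iterated limit, [x] first and the cut-off [A] afterwards: for a fixed [A]
    the middle part of f * f is in general of the same order as [f], since it
    carries the mass of [f] beyond [A]. *)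
Definition negligible_middle {R : realType} (f g k : R -> R) : Prop :=
  forall d, 0 < d -> \forall A \near +oo, \forall x \near +oo,
    (conv_over f g `[A, (x - A)%R] x <= (d * k x)%:E)%E.

(** In the middle part both arguments [y] and [x - y] are at least [A], so domination
    far out suffices; the constants multiply to [c ^+ 3]. *)
Lemma negligible_middle_dominated {R : realType} (c : R)
    (f1 g1 k1 f2 g2 k2 : R -> R) :
  prob_density f1 -> prob_density g1 -> prob_density f2 -> prob_density g2 ->
  0 < c ->
  (\forall x \near +oo, f1 x <= c * f2 x) ->
  (\forall x \near +oo, g1 x <= c * g2 x) ->
  (\forall x \near +oo, k2 x <= c * k1 x) ->
  negligible_middle f2 g2 k2 -> negligible_middle f1 g1 k1.
Proof.
move=> [mf1 f10 _] [mg1 g10 _] [mf2 f20 _] [mg2 g20 _] c0 f12 g12 k12 nm d d0.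
have c20 : 0 <= c ^+ 2 by rewrite exprn_ge0// ltW.
have c2p : 0 < c ^+ 2 by rewrite exprn_gt0.
have d'0 : 0 < d / c ^+ 3 by rewrite divr_gt0// exprn_gt0.
move: f12 g12 => [X [_ f12]] [X' [_ g12]].
near=> A.
have XA : X < A by near: A; exact: near_pinfty_lt.
have XA' : X' < A by near: A; exact: near_pinfty_lt.
have : \forall x \near +oo,
    (conv_over f2 g2 `[A, (x - A)%R] x <= (d / c ^+ 3 * k2 x)%:E)%E.
  by near: A; exact: nm.
move=> mid; near=> x.
apply: (@le_trans _ _ ((c ^+ 2)%:E * conv_over f2 g2 `[A, (x - A)%R] x)%E).
  rewrite /conv_over -ge0_integralZl_EFin//; last 2 first.
  - by move=> y _; rewrite lee_fin mulr_ge0.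
  - by apply: measurable_funTS; exact: measurable_conv_integrand.
  apply: ge0_le_integral => //.
  - by move=> y _; rewrite lee_fin mulr_ge0.
  - by apply: measurable_funTS; exact: measurable_conv_integrand.
  - apply: measurable_funTS; apply: emeasurable_funM => //.
    exact: measurable_conv_integrand.
  - move=> y; rewrite /= in_itv/= => /andP[Ay yA].
    rewrite -EFinM lee_fin expr2 mulrACA ler_pM//.
      by apply: f12; lra.
    by apply: g12; lra.
apply: (@le_trans _ _ ((c ^+ 2)%:E * (d / c ^+ 3 * k2 x)%:E)%E).
  by rewrite lee_wpmul2l ?lee_fin//; near: x.
rewrite -EFinM lee_fin.
apply: (@le_trans _ _ (c ^+ 2 * (d / c ^+ 3 * (c * k1 x)))).
  by rewrite ler_wpM2l// (ler_wpM2l (ltW d'0))//; near: x.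
rewrite le_eqVlt; apply/orP; left; apply/eqP; field; lra.
Unshelve. all: by end_near. Qed.

Lemma negligible_middle_asymp_equiv {R : realType} (f g : R -> R) :
  prob_density_Rplus f -> prob_density_Rplus g -> long_tailed f ->
  (forall eps, 0 < eps -> \forall x \near +oo, g x <= eps * f x) ->
  negligible_middle f g f -> asymp_equiv f (convolution f g).
Proof.
move=> fd gd fL gf nm; apply: asymp_equiv_convolution => // eps eps0 eps1.
have [A [midA massA]] :=
  filter_ex (filterI (nm _ eps0) (head_mass_cvg1 gd.1 eps0)).
have [X [_ gX]] := gf _ eps0.
near=> x; exists A.
have xA : 2 * A < x by near: x; exact: near_pinfty_lt.
have xX : X + A < x by near: x; exact: near_pinfty_lt.
split=> //.
- lra.
- by near: x; exact: near_flat_window.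
- by move=> y y0 yA; apply: gX; lra.
- by near: x.
Unshelve. all: by end_near. Qed.

(** Both heads of f * f are close to f(x), so their sum is close to 2 f(x). *)
Lemma negligible_middle_subexponential {R : realType} (f : R -> R) :
  prob_density_Rplus f -> long_tailed f ->
  negligible_middle f f f -> subexponential f.
Proof.
move=> fd fL nm; split=> //; first exact: fd.1.
have [pf _] := fd; have [mf f0 _] := fL.
have fp := long_tailed_gt0 fL.
have fp2 : \forall x \near +oo, 0 < 2 * f x.
  by apply: filterS fp => x fx; rewrite mulr_gt0.
apply/(asymp_equivP _ fp2) => e e0.
pose eps := Num.min 1 (e / 4).
have eps0 : 0 < eps by rewrite lt_min ltr01; lra.
have eps1 : eps <= 1 by rewrite ge_min lexx.
have epse : eps <= e / 4 by rewrite ge_min lexx orbT.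
have [A [midA massA]] :=
  filter_ex (filterI (nm _ eps0) (head_mass_cvg1 pf eps0)).
near=> x.
have xA : 2 * A < x by near: x; exact: near_pinfty_lt.
have ax : A <= x - A by lra.
have fa : flat_window f eps A x by near: x; exact: near_flat_window.
have mid : (conv_over f f `[A, (x - A)%R] x <= (eps * f x)%:E)%E.
  by near: x.
have h1 := flat_window_head_le fd fd (ltW eps0) fa.
have h2 := flat_window_head_ge fd fd (ltW eps0) eps1 fa massA.
rewrite convolutionE (conv_over_split pf pf ax).
move: h1 h2 mid (conv_over_ge0 `[A, (x - A)%R] x f0 f0).
case: (conv_over f f `]-oo, A[ x) => [p||]//.
case: (conv_over f f `[A, (x - A)%R] x) => [q||]//.
rewrite !lee_fin /= => h1 h2 h4 h5.
have fx := f0 x.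
have : eps * f x <= e / 4 * f x by rewrite ler_wpM2r.
rewrite ler_norml => h7; apply/andP; split; lra.
Unshelve. all: by end_near. Qed.

(** The heads already account for almost all of 2 f(x), which leaves little room
    for the middle part. *)
Lemma subexponential_negligible_middle {R : realType} (f : R -> R) :
  prob_density_Rplus f -> subexponential f -> negligible_middle f f f.
Proof.
move=> fd [pf fL ff] d d0; have [mf f0 _] := fL.
(* The middle part is at most [2 + 2 eps - 2 (1 - 2 eps) = 6 eps] times [f x]. *)
pose eps := Num.min 1 (d / 6).
have eps0 : 0 < eps by rewrite lt_min ltr01; lra.
have eps1 : eps <= 1 by rewrite ge_min lexx.
have epsd : eps <= d / 6 by rewrite ge_min lexx orbT.
have f20 x : 0 <= 2 * f x by rewrite mulr_ge0.
move: (ff) => /(asymp_equivP _ (asymp_equiv_gt0 f20 ff))/(_ _ eps0) {}ff.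
have tf := long_tailed_tail_bounded fL.
have ffin := near_conv_over_fin fd fd tf tf.
near=> A.
have massA : ((1 - eps)%:E <= head_mass f A)%E.
  by near: A; exact: head_mass_cvg1.
near=> x.
have xA : 2 * A < x by near: x; exact: near_pinfty_lt.
have ax : A <= x - A by lra.
have fa : flat_window f eps A x by near: x; exact: near_flat_window.
have h2 := flat_window_head_ge fd fd (ltW eps0) eps1 fa massA.
have fin : (conv_over f f setT x < +oo)%E by near: x.
have : `|convolution f f x - 2 * f x| <= eps * (2 * f x) by near: x.
move: fin h2 (conv_over_ge0 `[A, (x - A)%R] x f0 f0).
rewrite convolutionE (conv_over_split pf pf ax).
case: (conv_over f f `]-oo, A[ x) => [p||];
  case: (conv_over f f `[A, (x - A)%R] x) => [q||]//.
rewrite !lee_fin /= => _ h2 h5; rewrite ler_norml => /andP[_ h6].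
have fx := f0 x.
have : eps * f x <= d / 6 * f x by rewrite ler_wpM2r.
lra.
Unshelve. all: by end_near. Qed.

(** * The convolution of two densities is a density *)

Lemma integral_shift {R : realType} (y : R) (f : R -> \bar R) :
  measurable_fun [set: R] f -> (forall y, 0 <= f y)%E ->
  (\int[lebesgue_measure]_x f (x - y)%R = \int[lebesgue_measure]_x f x)%E.
Proof.
move=> mf f0; have msub : measurable_fun [set: R] (fun x : R => x - y).
  exact: measurable_funB.
rewrite (integral_reflect y)//; last exact: (measurableT_comp mf msub).
rewrite [RHS](integral_reflect 0)// !preimage_setT.
by apply: eq_integral => x _; congr f; ring.
Qed.

Lemma measurable_conv_kernel {R : realType} (f g : R -> R) :
  measurable_fun [set: R] f -> measurable_fun [set: R] g ->
  measurable_fun [set: R * R] (fun z : R * R => (f (z.1 - z.2) * g z.2)%:E).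
Proof.
move=> mf mg; apply/measurable_EFinP/measurable_funM.
  apply: (@measurableT_comp _ _ _ _ _ _ f) => //; exact: measurable_funB.
exact: measurableT_comp.
Qed.

(** Tonelli's theorem and translation invariance. *)
Lemma integral_conv_over {R : realType} (f g : R -> R) :
  prob_density f -> prob_density g ->
  (\int[lebesgue_measure]_x conv_over f g setT x = 1)%E.
Proof.
move=> [mf f0 f1] [mg g0 g1].
rewrite /conv_over.
have := @fubini_tonelli _ _ _ _ _ (@lebesgue_measure R) (@lebesgue_measure R)
  (fun z : R * R => (f (z.1 - z.2) * g z.2)%:E).
move=> /= ->; last 2 first.
- exact: measurable_conv_kernel.
- by move=> z; rewrite lee_fin mulr_ge0.
rewrite -g1; apply: eq_integral => y _ /=.
under eq_integral => x _ do rewrite mulrC EFinM.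
rewrite ge0_integralZl_EFin//; last 2 first.
- by move=> x _; rewrite lee_fin.
- apply/measurable_EFinP; apply: (@measurableT_comp _ _ _ _ _ _ f) => //.
  exact: measurable_funB.
rewrite (integral_shift y (f := EFin \o f))//; last exact/measurable_EFinP.
by rewrite f1 mule1.
Qed.

Lemma measurable_conv_over {R : realType} (f g : R -> R) :
  measurable_fun [set: R] f -> measurable_fun [set: R] g ->
  (forall x, 0 <= f x) -> (forall x, 0 <= g x) ->
  measurable_fun [set: R] (conv_over f g setT).
Proof.
move=> mf mg f0 g0.
apply: (@measurable_fun_fubini_tonelli_F _ _ _ _ _ (@lebesgue_measure R)
  (fun z : R * R => (f (z.1 - z.2) * g z.2)%:E)).
- exact: measurable_conv_kernel.
- by move=> z; rewrite lee_fin mulr_ge0.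
Qed.

(** The convolution integral has total mass 1, so it is finite almost everywhere,
    and its finite version [convolution] keeps the same integral. *)
Lemma prob_density_convolution {R : realType} (f g : R -> R) :
  prob_density_Rplus f -> prob_density_Rplus g ->
  prob_density_Rplus (convolution f g).
Proof.
move=> [pf fN] [pg gN]; have [mf f0 _] := pf; have [mg g0 _] := pg.
have mH := measurable_conv_over mf mg f0 g0.
have H0 x : (0 <= conv_over f g setT x)%E by exact: conv_over_ge0.
have mh : measurable_fun [set: R] (convolution f g).
  by rewrite (funext (convolutionE f g)); apply: measurableT_comp mH.
split; last first.
  move=> x x0; rewrite convolutionE /conv_over integral0_eq// => y _.
  have [y0|y0] := ltP y 0; first by rewrite gN// mulr0.
  by rewrite fN ?mul0r//; lra.
split => //; first by move=> x; rewrite convolutionE fine_ge0.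
rewrite -(integral_conv_over pf pg); apply: ge0_ae_eq_integral => //.
- exact/measurable_EFinP.
- by move=> x _; rewrite lee_fin convolutionE fine_ge0.
have : lebesgue_measure.-integrable setT (conv_over f g setT).
  apply/integrableP; split => //.
  under eq_integral => x _ do rewrite gee0_abs//.
  by rewrite integral_conv_over// ltry.
move=> /(integrable_ae measurableT); apply: filterS => x /(_ I) Hx _.
by rewrite convolutionE fineK.
Qed.

(** * Comparison of a density with its convolution *)

Lemma subexponential_asymp {R : realType} (f h : R -> R) :
  prob_density_Rplus f -> prob_density_Rplus h ->
  asymp_equiv f h -> subexponential f -> subexponential h.
Proof.
move=> fd hd fh fS; have [pf fL _] := fS; have [_ f0 _] := fL.
have [[mh h0 _] _] := hd.
apply: (negligible_middle_subexponential hd (long_tailed_asymp mh h0 fh fL)).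
have hf := asymp_equiv_le2 f0 (asymp_equiv_sym fh).
have [ph _] := hd.
apply: (negligible_middle_dominated ph ph pf pf (ltr0Sn R 1) hf hf
  (asymp_equiv_le2 h0 fh)).
exact: subexponential_negligible_middle.
Qed.

Lemma subexponential_convolution_asymp {R : realType} (f g : R -> R) :
  prob_density_Rplus f -> prob_density_Rplus g ->
  (forall eps, 0 < eps -> \forall x \near +oo, g x <= eps * f x) ->
  subexponential f -> asymp_equiv f (convolution f g).
Proof.
move=> fd gd gf fS; have [pf fL _] := fS; have [pg _] := gd.
apply: negligible_middle_asymp_equiv => //.
have ff : \forall x \near +oo, f x <= 1 * f x by near=> x; rewrite mul1r.
apply: (negligible_middle_dominated pf pg pf pf ltr01 ff (gf 1 ltr01) ff).
exact: subexponential_negligible_middle.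
Unshelve. all: by end_near. Qed.

(** Only the head of f * g is used, with 3/4 of the mass of [g] and a relative
    variation of at most 1/4 of [f]. *)
Lemma le_convolution_near {R : realType} (f g : R -> R) :
  prob_density_Rplus f -> prob_density_Rplus g -> long_tailed f ->
  tail_bounded g -> \forall x \near +oo, f x <= 2 * convolution f g x.
Proof.
move=> fd gd fL tg; have [pf _] := fd; have [pg _] := gd; have [_ f0 _] := fL.
have e4 : 0 < 1 / 4 :> R by lra.
have e41 : 1 / 4 <= 1 :> R by lra.
have [A massA] := filter_ex (head_mass_cvg1 pg e4).
have fin := near_conv_over_fin fd gd (long_tailed_tail_bounded fL) tg.
near=> x.
have fa : flat_window f (1 / 4) A x by near: x; exact: near_flat_window.
have : (conv_over f g setT x < +oo)%E by near: x.
have h1 := flat_window_head_ge fd gd (ltW e4) e41 fa massA.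
have := conv_over_le x pf pg (measurable_itv `]-oo, A[) measurableT
  (@subsetT _ _).
move=> /(le_trans h1); rewrite convolutionE.
case: (conv_over f g setT x) => [p||]//=; rewrite lee_fin; lra.
Unshelve. all: by end_near. Qed.

(** Subexponentiality of h = f * g controls the middle part of f * g relative to h.
    To control it relative to [f], the bound h <= C f is needed first; it comes
    from absorbing half of h on the left of h <= heads + h / 2. *)
Lemma convolution_subexponential_asymp {R : realType} (f g : R -> R) :
  prob_density_Rplus f -> prob_density_Rplus g -> long_tailed f ->
  (forall eps, 0 < eps -> \forall x \near +oo, g x <= eps * f x) ->
  subexponential (convolution f g) -> asymp_equiv f (convolution f g).
Proof.
move=> fd gd fL gf hS; have [pf _] := fd; have [pg _] := gd; have [_ f0 _] := fL.
have g0 : forall x, 0 <= g x by case: pg.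
have hd := prob_density_convolution fd gd.
have [ph _] := hd; have [_ h0 _] := ph.
have tf := long_tailed_tail_bounded fL.
have gf1 := gf 1 ltr01.
have tg := tail_bounded_le ler01 gf1 tf.
have fh := le_convolution_near fd gd fL tg.
have gh : \forall x \near +oo, g x <= 2 * convolution f g x.
  near=> x; apply: (@le_trans _ _ (1 * f x)); first by near: x.
  by rewrite mul1r; near: x.
have nm : negligible_middle f g (convolution f g).
  have hh : \forall x \near +oo, convolution f g x <= 2 * convolution f g x.
    by near=> x; have := h0 x; lra.
  apply: (negligible_middle_dominated pf pg ph ph (ltr0Sn R 1) fh gh hh).
  exact: subexponential_negligible_middle.
have fin := near_conv_over_fin fd gd tf tg.
have hf : \forall x \near +oo, convolution f g x <= 8 * f x.
  have e2 : 0 < 1 / 2 :> R by lra.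
  have [A mid] := filter_ex (nm _ e2).
  have [X [_ gX]] := gf1.
  near=> x.
  have xX : X + A < x by near: x; exact: near_pinfty_lt.
  have xA : 2 * A < x by near: x; exact: near_pinfty_lt.
  have ax : A <= x - A by lra.
  have fa : flat_window f 1 A x by near: x; exact: near_flat_window.
  (* Heads at most [2 f x] each and middle part at most [h x / 2]. *)
  have h1 := flat_window_head_le fd gd ler01 fa.
  have h3 :=
    @flat_window_head2_le _ f g 1 1 A x fd gd ler01 ler01 (lexx 1) fa.
  have {}h3 := h3 (fun y _ yA => gX (x - y) ltac:(lra)).
  have : (conv_over f g `[A, (x - A)%R] x <=
    (1 / 2 * convolution f g x)%:E)%E by near: x.
  have : (conv_over f g setT x < +oo)%E by near: x.
  move: h1 h3 (conv_over_ge0 `]-oo, A[ x f0 g0)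
    (conv_over_ge0 `[A, (x - A)%R] x f0 g0)
    (conv_over_ge0 `]-oo, A[ x g0 f0).
  rewrite convolutionE (conv_over_split pf pg ax).
  case: (conv_over f g `]-oo, A[ x) => [p||]//.
  case: (conv_over g f `]-oo, A[ x) => [r||]//.
  case: (conv_over f g `[A, (x - A)%R] x) => [q||]//.
  rewrite !lee_fin /= => *; lra.
apply: negligible_middle_asymp_equiv => //.
have ff : \forall x \near +oo, f x <= 8 * f x by near=> x; have := f0 x; lra.
have gg : \forall x \near +oo, g x <= 8 * g x by near=> x; have := g0 x; lra.
exact: (negligible_middle_dominated pf pg pf pg (ltr0Sn R 7) ff gg hf nm).
Unshelve. all: by end_near. Qed.

(** Here the cut is at [alpha x]; since [alpha x < x / 2] far out, the last head
    evaluates [g] beyond [x / 2] only, where it is small with respect to [f]. *)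
Lemma insensitive_convolution_asymp {R : realType} (f g alpha : R -> R) :
  prob_density_Rplus f -> prob_density_Rplus g -> long_tailed f ->
  (forall eps, 0 < eps -> \forall x \near +oo, g x <= eps * f x) ->
  (\forall x \near +oo, alpha x < x / 2) ->
  alpha x @[x --> +oo] --> +oo -> insensitive alpha f ->
  (forall eps, 0 < eps -> \forall x \near +oo,
    \int[@lebesgue_measure R]_(y in `[alpha x, x - alpha x]) (f (x - y) * g y)
      <= eps * f x) ->
  asymp_equiv f (convolution f g).
Proof.
move=> fd gd fL gf ax2 ay fa mid; have [pf _] := fd; have [pg _] := gd.
have tf := long_tailed_tail_bounded fL; have [_ f0 _] := fL.
have g0 : forall x, 0 <= g x by case: pg.
have gf1 := gf 1 ltr01.
have fin := near_conv_over_fin fd gd tf (tail_bounded_le ler01 gf1 tf).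
apply: asymp_equiv_convolution => // eps eps0 eps1.
have massA := ay _ (head_mass_cvg1 pg eps0).
have [X [_ gX]] := gf _ eps0.
have {}fa := fa _ eps0; have {}mid := mid _ eps0.
near=> x; exists (alpha x).
have ax : alpha x < x / 2 by near: x.
have xX : 2 * X < x by near: x; exact: near_pinfty_lt.
split.
- lra.
- move=> y y0 ya.
  have : (ereal_sup [set `|f (x + y) - f x|%:E | y in [set y | `|y| <= alpha x]%R]
      <= (eps * f x)%:E)%E by near: x.
  move/ereal_supP => /(_ (`|f (x - y) - f x|%:E)); rewrite lee_fin; apply.
  by exists (- y) => //=; rewrite normrN ger0_norm// ltW.
- by move=> y y0 ya; apply: gX; lra.
- by near: x.
- have finx : (conv_over f g setT x < +oo)%E by near: x.
  have le := conv_over_le x pf pg (measurable_itv `[alpha x, x - alpha x])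
    measurableT (@subsetT _ _).
  have := conv_over_ge0 `[alpha x, x - alpha x] x f0 g0.
  have : \int[@lebesgue_measure R]_(y in `[alpha x, x - alpha x])
    (f (x - y) * g y)
    <= eps * f x by near: x.
  rewrite -[Rintegral _ _ _]/(fine (conv_over f g `[alpha x, x - alpha x] x)).
  by move: (le_lt_trans le finx); case: (conv_over _ _ _ _) => [q||].
Unshelve. all: by end_near. Qed.

Lemma nonneg_littleo {R : realType} (u f : R -> R) :
  (forall x, 0 <= f x) -> u =o_ (pinfty_nbhs R) f ->
  forall eps, 0 < eps -> \forall x \near +oo, u x <= eps * f x.
Proof.
move=> f0 uf eps eps0; have := eq_some_oP uf; move=> /(_ _ eps0).
apply: filterS => x; rewrite [X in _ * X]ger0_norm//; apply: le_trans.
exact: ler_norm.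
Qed.

Unset Implicit Arguments.

Theorem lemma2p2 (R : realType) (f g : R -> R)
  (hf : prob_density_Rplus f) (hg : prob_density_Rplus g)
  (hfL : long_tailed f) (hgf : g =o_ (pinfty_nbhs R) f) :
  ((subexponential (convolution f g) <-> subexponential f) /\
   (subexponential f -> asymp_equiv f (convolution f g))) /\
  (forall alpha : R -> R,
     (\forall x \near +oo, alpha x < x / 2) ->
     alpha x @[x --> +oo] --> +oo ->
     insensitive alpha f ->
     (fun x : R => \int[@lebesgue_measure R]_(y in `[alpha x, x - alpha x])
                     (f (x - y) * g y)) =o_ (pinfty_nbhs R) f ->
     (long_tailed f /\ ~ subexponential f <->
      long_tailed (convolution f g) /\ ~ subexponential (convolution f g)) /\
     (long_tailed f /\ ~ subexponential f -> asymp_equiv f (convolution f g))).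
Proof.
have [_ f0 _] := hfL.
have gf := nonneg_littleo f0 hgf.
have hd := prob_density_convolution hf hg; have [[mh h0 _] _] := hd.
have fS : subexponential f -> asymp_equiv f (convolution f g).
  exact: subexponential_convolution_asymp.
have hS : subexponential (convolution f g) <-> subexponential f.
  split=> S; last exact: (subexponential_asymp hf hd (fS S) S).
  apply: (subexponential_asymp hd hf _ S); apply: asymp_equiv_sym.
  exact: convolution_subexponential_asymp.
split=> // alpha ax2 ay fa mid.
have fh : asymp_equiv f (convolution f g).
  exact: (insensitive_convolution_asymp hf hg hfL gf ax2 ay fa
    (nonneg_littleo f0 mid)).
have hL := long_tailed_asymp mh h0 fh hfL.
by rewrite hS; split => //; split=> -[].
Qed.
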